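(* For a fixed graph $F$, if $G_0$ and $G_1$ are graphs such that $V(G_1)=V(G_0)\cup\{v_1\}$, where $\deg(v_1)=0$ (in $G_1$), and $E(G_1)=E(G_0)$, then $t(G_0,F)=t(G_1,F)$.
   Context: All graphs are simple and undirected (no loops, at most one edge between each pair of vertices), finite, and have at least one vertex. $V(G)$ and $E(G)$ denote the vertex and edge sets of $G$; $\deg(v)$ is the number of edges having $v$ as an endpoint. A mapping $\varphi:G\to F$ between graphs means an arbitrary function $V(G)\to V(F)$. It is a graph homomorphism if $v_1v_2\in E(G)$ implies $\varphi(v_1)\varphi(v_2)\in E(F)$. The homomorphism density is $t(G,F)=\frac{|H|}{|M|}$, where $M$ is the set of all mappings from $G$ to $F$ and $H\subseteq M$ is the set of those that are graph homomorphisms. *)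

(* Defs.v *)
From HB Require Import structures.
From mathcomp Require Import all_boot all_order all_algebra.
From mathcomp Require Import finmap.

Set Implicit Arguments.
Unset Strict Implicit.
Unset Printing Implicit Defensive.

Import GRing.Theory Num.Theory.
Local Open Scope fset_scope.
Local Open Scope ring_scope.

(* An edge is the set of its two endpoints, so the cardinality condition rules
   out loops, and edges are undirected and without multiplicity. *)
Record sgraph (K : choiceType) := SGraph {
  vertices : {fset K};
  edges : {fset {fset K}};
  vertices_neq0 : vertices != fset0;
  edgesP : forall e, e \in edges -> e `<=` vertices /\ #|` e| = 2%N
}.

Definition deg (K : choiceType) (G : sgraph K) (v : K) : nat :=
  #|` [fset e in edges G | v \in e]|.

Definition mapping (K L : choiceType) (G : sgraph K) (F : sgraph L) : finType :=
  {ffun vertices G -> vertices F}.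

Definition is_hom (K L : choiceType) (G : sgraph K) (F : sgraph L)
    (phi : {ffun vertices G -> vertices F}) : bool :=
  [forall v1 : vertices G, forall v2 : vertices G,
     ([fset val v1; val v2] \in edges G) ==>
     ([fset val (phi v1); val (phi v2)] \in edges F)].

Definition hom_density (K L : choiceType) (G : sgraph K) (F : sgraph L) : rat :=
  #|[set phi : mapping G F | is_hom phi]|%:R / #|mapping G F|%:R.

(* Main.v *)
Require Import Defs.
From HB Require Import structures.
From mathcomp Require Import all_boot all_order all_algebra.
From mathcomp Require Import finmap.

Set Implicit Arguments.
Unset Strict Implicit.
Unset Printing Implicit Defensive.

Import GRing.Theory Num.Theory.
Local Open Scope fset_scope.
Local Open Scope ring_scope.

(** A mapping on the vertices of [G1] amounts to a mapping on those of [G0]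
    together with an arbitrary choice of images for the remaining vertices.
    Hence all fibres of the restriction map from mappings on [G1] to mappings
    on [G0] have the same cardinality, [restrict_fibre_card], which is positive
    because [F] has a vertex.  Every edge of [G1] is an edge of [G0], so that
    its endpoints lie in [G0], and a mapping on [G1] is a homomorphism exactly
    when its restriction is one, [is_hom_restrict].  Passing from [G0] to [G1]
    therefore multiplies the number of homomorphisms and the number of mappings
    by the same nonzero factor, and the density does not change.

    The argument works for any number of added isolated vertices, including
    none: in the theorem, [v1] may already be a vertex of [G0]. *)

Lemma card_preimset_const (A B : finType) (f : A -> B) (c : nat) (S : {set B}) :
  (forall y, #|[set x | f x == y]| = c) -> #|f @^-1: S| = (#|S| * c)%N.
Proof.
move=> fibre_c; rewrite -sum1_card (partition_big f (mem S)) /=; last first.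
  by move=> x; rewrite inE.
rewrite -sum_nat_const; apply: eq_bigr => y yS.
rewrite -(fibre_c y) -sum1_card; apply: eq_bigl => x.
by rewrite !inE andbC; case: eqP => // ->; rewrite yS.
Qed.

Section Restriction.

Variables (K : choiceType) (T : finType) (V0 V1 : {fset K}).
Hypothesis sV : V0 `<=` V1.

Definition restrict (phi : {ffun V1 -> T}) : {ffun V0 -> T} :=
  [ffun x => phi (fincl sV x)].

(** The factor at [x] is the number of values that a mapping may take at [x]
    once its restriction to [V0] is prescribed: the product is the number of
    extensions of a mapping from [V0] to [V1]. *)
Definition extension_count : nat :=
  \prod_(x : V1) (if val x \in V0 then 1 else #|T|)%N.

(** The fibre over [psi] is a product of sets indexed by [V1]: a singleton at
    each vertex of [V0] and all of [T] elsewhere. *)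
Lemma restrict_fibre_card (psi : {ffun V0 -> T}) :
  #|[set phi | restrict phi == psi]| = extension_count.
Proof.
pose Fx (x : V1) : pred T :=
  if insub (val x) is Some y then pred1 (psi y) else predT.
have -> : #|[set phi | restrict phi == psi]| = #|(family Fx : {pred _})|.
  apply: eq_card => phi; rewrite inE; apply/eqP/familyP => [psiE x|Fphi].
    rewrite /Fx; case: insubP => [y _ xy|//].
    rewrite inE -psiE ffunE; apply/eqP; congr (phi _).
    by apply: val_inj; rewrite /= -xy.
  apply/ffunP => y; rewrite ffunE.
  by move: (Fphi (fincl sV y)); rewrite /Fx /= valK inE => /eqP.
rewrite card_family foldrE big_map big_enum; apply: eq_bigr => x _.
rewrite /Fx; case: insubP => [y xV0 _|/negPf ->]; last exact: eq_card.
by rewrite xV0 card1.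
Qed.

Lemma extension_count_gt0 : (0 < #|T|)%N -> (0 < extension_count)%N.
Proof. by move=> T_gt0; apply: prodn_gt0 => x; case: ifP. Qed.

End Restriction.

Section ExtraVertices.

Variables (K L : choiceType) (F : sgraph L) (G0 G1 : sgraph K).
Hypotheses (sV : vertices G0 `<=` vertices G1) (eqE : edges G1 = edges G0).

Lemma is_hom_restrict (phi : {ffun vertices G1 -> vertices F}) :
  is_hom (restrict sV phi : {ffun vertices G0 -> vertices F}) = is_hom phi.
Proof.
apply/'forall_forallP/'forall_forallP => hom_phi x y.
  apply/implyP; rewrite eqE => xyE.
  have [/fsubsetP sxy _] := edgesP xyE.
  have xV0 : val x \in vertices G0 by apply: sxy; rewrite fset21.
  have yV0 : val y \in vertices G0 by apply: sxy; rewrite fset22.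
  have /implyP/(_ xyE) := hom_phi [` xV0] [` yV0].
  have incl_x : fincl sV [` xV0] = x by exact: val_inj.
  have incl_y : fincl sV [` yV0] = y by exact: val_inj.
  by rewrite !ffunE incl_x incl_y.
by move: (hom_phi (fincl sV x) (fincl sV y)); rewrite eqE !ffunE.
Qed.

Lemma hom_density_extra_vertices : hom_density G0 F = hom_density G1 F.
Proof.
pose r (phi : mapping G1 F) : mapping G0 F := restrict sV phi.
pose c := extension_count (vertices F) (vertices G0) (vertices G1).
have fibre_c psi : #|[set phi | r phi == psi]| = c.
  exact: restrict_fibre_card.
have c_neq0 : c%:R != 0 :> rat.
  rewrite pnatr_eq0 -lt0n; apply: extension_count_gt0.
  by rewrite -cardfE cardfs_gt0 vertices_neq0.
have homs : #|[set phi : mapping G1 F | is_hom phi]| =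
            (#|[set psi : mapping G0 F | is_hom psi]| * c)%N.
  rewrite -(card_preimset_const _ fibre_c); apply: eq_card => phi.
  by rewrite !inE is_hom_restrict.
have maps : #|mapping G1 F| = (#|mapping G0 F| * c)%N.
  by rewrite -!cardsT -(card_preimset_const _ fibre_c) preimsetT.
by rewrite /hom_density homs maps !natrM -mulf_div divff // mulr1.
Qed.

End ExtraVertices.

Theorem theorem2p6 (L : choiceType) (F : sgraph L)
    (K : choiceType) (G0 G1 : sgraph K) (v1 : K)
    (hV : vertices G1 = vertices G0 `|` [fset v1])
    (hdeg : deg G1 v1 = 0%N)
    (hE : edges G1 = edges G0) :
  hom_density G0 F = hom_density G1 F.
Proof. by apply: hom_density_extra_vertices hE; rewrite hV fsubsetUl. Qed.
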